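(* Let $n,r,v,e$ be positive integers with $e\ge 2$, and write $er=v+p(e-1)+q$ with integers $p$ and $1\le q\le e-1$. Then $$f_r(n,v,e)\le q\binom{n}{p+1}\Big/\binom{r}{p+1}+(e-1-q)\binom{n}{p}\Big/\binom{r}{p}.$$ Equivalently, $$f_r(n,v,e)\le q\binom{n}{\lceil\frac{er-v}{e-1}\rceil}\Big/\binom{r}{\lceil\frac{er-v}{e-1}\rceil}+(e-1-q)\binom{n}{\lfloor\frac{er-v}{e-1}\rfloor}\Big/\binom{r}{\lfloor\frac{er-v}{e-1}\rfloor}.$$
   Context: For integers $r,v,e$, an $r$-uniform hypergraph is called $\mathcal{G}_r(v,e)$-free if the union of any $e$ distinct edges has at least $v+1$ vertices. $f_r(n,v,e)$ denotes the maximum number of edges in a $\mathcal{G}_r(v,e)$-free $r$-uniform hypergraph on $n$ vertices. *)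

(* Defs.v *)
From mathcomp Require Import all_boot all_order all_algebra.

Set Implicit Arguments.
Unset Strict Implicit.
Unset Printing Implicit Defensive.

Import Order.TTheory GRing.Theory Num.Theory.
Local Open Scope ring_scope.

(* A hypergraph is identified with its edge set, so it has no repeated edges. *)
Definition uniform (T : finType) (r : nat) (H : {set {set T}}) : bool :=
  [forall E in H, #|E| == r].

Definition Gfree (T : finType) (v e : nat) (H : {set {set T}}) : bool :=
  [forall S : {set {set T}},
    (S \subset H) && (#|S| == e) ==> (v.+1 <= #|cover S|)%N].

Definition turan (r n v e : nat) : nat :=
  (\max_(H : {set {set 'I_n}} | uniform r H && Gfree v e H) #|H|)%N.

(* The lower index may be negative, in which case the coefficient is 0. *)
Definition binz (n : nat) (k : int) : rat :=
  match k with
  | Posz m => 'C(n, m)%:R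
  | Negz _ => 0
  end.

(* Main.v *)
Require Import Defs.
From mathcomp Require Import all_boot all_order all_algebra.
From mathcomp Require Import zify ring lra.

Set Implicit Arguments.
Unset Strict Implicit.
Unset Printing Implicit Defensive.

Import Order.TTheory GRing.Theory Num.Theory.
Local Open Scope ring_scope.

(** Call a family of edges a t-packing if distinct members share fewer than t
    vertices; double counting t-subsets, it has at most C(n,t)/C(r,t) members.
    Remove from H successively q maximal (p+1)-packings and e-1-q maximal
    p-packings.  If an edge E survives, then by maximality it meets some member
    of each packing in at least p+1, respectively p, vertices.  Together with E
    these e edges span at most er - q(p+1) - (e-1-q)p = v vertices. *)

Definition packing (T : finType) (t : nat) (M : {set {set T}}) : bool :=
  [forall A in M, forall B in M, (t <= #|A :&: B|)%N ==> (A == B)].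

Lemma packingP (T : finType) (t : nat) (M : {set {set T}}) :
  reflect {in M &, forall A B : {set T}, (t <= #|A :&: B|)%N -> A = B}
          (packing t M).
Proof.
apply: (iffP forall_inP) => [packM A B AM BM tAB | packM A AM].
  by have /forall_inP/(_ B BM)/implyP/(_ tAB)/eqP := packM A AM.
by apply/forall_inP => B BM; apply/implyP => tAB; apply/eqP/packM.
Qed.

Lemma uniformW (T : finType) (r : nat) (H M : {set {set T}}) :
  M \subset H -> uniform r H -> uniform r M.
Proof.
move=> /subsetP sMH /forall_inP uH.
by apply/forall_inP => A /sMH; apply: uH.
Qed.

(** Count pairs of an edge of [M] and a [t]-subset of it: every edge gives ['C(r, t)] pairs, and
    every [t]-set occurs in at most one. *)
Lemma leq_packing_bin (T : finType) (r t : nat) (M : {set {set T}}) :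
  uniform r M -> packing t M -> (#|M| * 'C(r, t) <= 'C(#|T|, t))%N.
Proof.
move=> /forall_inP uM /packingP packM.
rewrite -[#|T|]cardsT -cards_draws -sum_nat_const.
have -> : (\sum_(A in M) 'C(r, t) =
    \sum_(A in M) \sum_(B : {set T} | (#|B| == t) && (B \subset A)) 1)%N.
  apply: eq_bigr => A /uM/eqP <-.
  rewrite sum1_card -cards_draws; apply: eq_card => B.
  by rewrite !inE andbC.
rewrite (exchange_big_dep (fun B : {set T} => #|B| == t)) /=; last first.
  by move=> A B _ /andP[].
rewrite -sum1_card [leqRHS](eq_bigl (fun B : {set T} => #|B| == t)); last first.
  by move=> B; rewrite !inE subsetT.
apply: leq_sum => B /eqP cardB; rewrite sum1_card.
(* Two edges through the same [t]-set [B] meet in at least [t] vertices, hence coincide. *)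
apply/card_le1_eqP => A2 A1 /and3P[A2M _ sBA2] /and3P[A1M _ sBA1].
by apply: packM => //; rewrite -cardB subset_leq_card // subsetI sBA1.
Qed.

Lemma maximal_packing (T : finType) (t : nat) (H : {set {set T}}) :
  exists M : {set {set T}}, [/\ M \subset H, packing t M &
    forall E : {set T}, E \in H :\: M ->
      exists2 A, A \in M & (t <= #|E :&: A|)%N].
Proof.
pose P (M : {set {set T}}) := (M \subset H) && packing t M.
have P0 : P set0.
  by rewrite /P sub0set; apply/packingP => A B; rewrite inE.
have [M /maxsetP[/andP[sMH packM] maxM] _] := maxset_exists P0.
exists M; split => // E /setDP[EH EnM].
have [/exists_inP[A AM tEA] | noA] :=
  boolP [exists A in M, (t <= #|E :&: A|)%N]; first by exists A.
(* An edge [E] far from all of [M] could be added to it, so maximality would put [E] in [M]. *)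
case/negP: EnM; rewrite -(maxM (E |: M)) ?setU11 ?subsetUr //.
rewrite /P subUset sub1set EH sMH /=.
have far A : A \in M -> (t <= #|E :&: A|)%N -> false.
  by move=> AM tEA; case/negP: noA; apply/exists_inP; exists A.
apply/packingP => A B /setU1P[->|AM] /setU1P[->|BM] // tAB.
- by have := far _ BM tAB.
- by rewrite setIC in tAB; have := far _ AM tAB.
- by move/packingP: packM; apply.
Qed.

(** Induction on [ts], removing one maximal [t]-packing at each step. [E] is kept apart from [S]
    because the edge taken from every packing must be close to this same [E]. *)
Lemma dense_subfamily (T : finType) (r : nat) (ts : seq nat)
    (H : {set {set T}}) :
  uniform r H -> all (fun t => t <= r)%N ts ->
  \sum_(t <- ts) 'C(#|T|, t)%:R / 'C(r, t)%:R < #|H|%:R :> rat ->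
  exists S : {set {set T}}, exists2 E, E \in H :\: S &
    [/\ S \subset H, #|S| = size ts &
        (#|E :|: cover S| + sumn ts <= r * (size ts).+1)%N].
Proof.
elim: ts H => [|t ts IH] H uH /=.
  rewrite big_nil ltr0n => _ /card_gt0P[E EH].
  exists set0, E; rewrite ?inE ?EH // sub0set cards0 /cover big_set0 setU0.
  by rewrite addn0 muln1 (eqP (forall_inP uH E EH)).
case/andP=> le_tr le_tsr; rewrite big_cons => ltH.
have [M [sMH packM nearM]] := maximal_packing t H.
have leM : #|M|%:R <= 'C(#|T|, t)%:R / 'C(r, t)%:R :> rat.
  rewrite ler_pdivlMr ?ltr0n ?bin_gt0 // -natrM ler_nat.
  exact: leq_packing_bin (uniformW sMH uH) packM.
have cardH : #|H|%:R = #|M|%:R + #|H :\: M|%:R :> rat.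
  by rewrite -natrD -(cardsID M H) (setIidPr sMH).
(* [M] uses up at most the first term of the sum, so [H :\: M] still exceeds the remaining terms. *)
have [|S [E /setDP[EHM EnS] [sSHM cardS dense]]] :=
  IH (H :\: M) (uniformW (subsetDl H M) uH) le_tsr.
  by lra.
have [A AM tEA] := nearM E EHM.
have AnS : A \notin S.
  by apply: contraL AM => /(subsetP sSHM)/setDP[].
have /setDP[EH EnM] := EHM.
exists (A |: S), E.
  rewrite !inE EH (negbTE EnS) orbF andbT.
  by apply: contraNneq EnM => ->.
split.
- by rewrite subUset sub1set (subsetP sMH) // (subset_trans sSHM) ?subsetDl.
- by rewrite cardsU1 AnS cardS.
have cardA : #|A| = r by apply/eqP/(forall_inP uH)/(subsetP sMH).
(* The overlap with [E] alone already provides [t] vertices, so [A] adds at most [r - t] new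
   ones. *)
have leI : (t <= #|A :&: (E :|: cover S)|)%N.
  by apply: leq_trans tEA _; rewrite subset_leq_card // setIC setIS // subsetUl.
have -> : E :|: cover (A |: S) = A :|: (E :|: cover S).
  by rewrite /cover bigcup_setU big_set1 setUCA.
have := cardsUI A (E :|: cover S).
rewrite cardA mulnS addnA => cardUI.
apply: leq_trans (leq_add (leqnn r) dense).
by rewrite addnA leq_add2r -cardUI leq_add2l.
Qed.

Lemma turan_le_sum (n r v : nat) (ts : seq nat) :
  all (fun t => t <= r)%N ts ->
  (r * (size ts).+1 <= v + sumn ts)%N ->
  (turan r n v (size ts).+1)%:R
    <= \sum_(t <- ts) 'C(n, t)%:R / 'C(r, t)%:R :> rat.
Proof.
move=> le_tsr le_v; rewrite /turan.
elim/big_ind: _ => [|a b lea leb|H /andP[uH /forallP freeH]].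
- by apply: sumr_ge0 => t _; rewrite divr_ge0 ?ler0n.
- by rewrite /maxn; case: ifP.
(* A larger [H] would contain [size ts] edges which, together with [E], span at most [v]
   vertices. *)
rewrite leNgt; apply/negP; rewrite -{1}(card_ord n).
case/(dense_subfamily uH le_tsr) => S [E /setDP[EH EnS] [sSH cardS dense]].
have /implyP := freeH (E |: S).
rewrite subUset sub1set EH sSH cardsU1 EnS cardS /= add1n eqxx => /(_ isT).
rewrite /cover bigcup_setU big_set1 => lt_v.
have := leq_trans (leq_add lt_v (leqnn (sumn ts))) (leq_trans dense le_v).
by rewrite addSn ltnn.
Qed.

Lemma turan_le_binz (n r v e : nat) (s t : int) (a b : nat) :
  binz r s != 0 -> binz r t != 0 ->
  e = (a + b).+1 -> e%:Z * r%:Z = v%:Z + a%:Z * s + b%:Z * t ->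
  (turan r n v e)%:Q
    <= a%:Q * (binz n s / binz r s) + b%:Q * (binz n t / binz r t).
Proof.
(* A nonzero [binz r s] forces [0 <= s <= r], so the indices become naturals bounded by [r]. *)
case: s => [s|s]; last by rewrite /binz eqxx.
case: t => [t|t]; last by rewrite /binz eqxx.
rewrite /binz !pnatr_eq0 -!lt0n !bin_gt0 => le_sr le_tr -> er_eq.
have := @turan_le_sum n r v (nseq a s ++ nseq b t).
rewrite size_cat !size_nseq all_cat !all_nseq le_sr le_tr !orbT sumn_cat.
rewrite !sumn_nseq big_cat !big_nseq !iter_addr !addr0 -!(mulr_natl (_ / _)).
by rewrite -!pmulrn; apply => //; nia.
Qed.

Theorem theorem7 (n r v e : nat) (p q : int)
    (n_gt0 : (0 < n)%N) (r_gt0 : (0 < r)%N) (v_gt0 : (0 < v)%N)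
    (e_ge2 : (2 <= e)%N)
    (q_bounds : 1 <= q <= e%:Z - 1)
    (er_eq : e%:Z * r%:Z = v%:Z + p * (e%:Z - 1) + q)
    (* the denominators of the bound do not vanish *)
    (ceil_ok : binz r (Num.ceil ((e%:Q * r%:Q - v%:Q) / (e%:Q - 1))) != 0)
    (floor_ok : binz r (Num.floor ((e%:Q * r%:Q - v%:Q) / (e%:Q - 1))) != 0) :
  (turan r n v e)%:Q
    <= q%:Q * (binz n (p + 1) / binz r (p + 1))
       + (e%:Q - 1 - q%:Q) * (binz n p / binz r p)
  /\
  (turan r n v e)%:Q
    <= q%:Q * (binz n (Num.ceil ((e%:Q * r%:Q - v%:Q) / (e%:Q - 1)))
               / binz r (Num.ceil ((e%:Q * r%:Q - v%:Q) / (e%:Q - 1))))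
       + (e%:Q - 1 - q%:Q)
         * (binz n (Num.floor ((e%:Q * r%:Q - v%:Q) / (e%:Q - 1)))
            / binz r (Num.floor ((e%:Q * r%:Q - v%:Q) / (e%:Q - 1)))).
Proof.
have e1_gt0 : 0 < e%:Q - 1 :> rat by rewrite subr_gt0 ltr1z; lia.
have [q1 q2] : 1 <= q /\ q <= e%:Z - 1 by apply/andP.
have er_eqQ : e%:Q * r%:Q - v%:Q = p%:Q * (e%:Q - 1) + q%:Q.
  have /(congr1 (fun x : int => x%:Q)) := er_eq.
  by rewrite !(intrD, intrM) mulrN1z => ->; ring.
have q1Q : 1 <= q%:Q by rewrite ler1z.
have q2Q : q%:Q <= e%:Q - 1.
  by have := q2; rewrite -(ler_int rat) intrD mulrN1z.
(* Here [x = p + q / (e - 1)] with the fraction in [(0, 1]]: the ceiling is always [p + 1], while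
   the floor is [p] only if [q < e - 1]. *)
set x := (e%:Q * r%:Q - v%:Q) / (e%:Q - 1) in ceil_ok floor_ok *.
have xE : x * (e%:Q - 1) = p%:Q * (e%:Q - 1) + q%:Q.
  by rewrite /x divfK ?er_eqQ // gt_eqF.
have ceilx : Num.ceil x = p + 1.
  apply: ceil_def; rewrite addrK intrD.
  by apply/andP; split; nra.
rewrite ceilx in ceil_ok *.
(* If [q = e - 1], the floor is [p + 1] and [floor_ok] does not speak of [binz r p]; the second
   coefficient vanishes, and [e - 1] packings of index [p + 1] give the bound. *)
have [q_eq | q_neq] := eqVneq q (e%:Z - 1).
  have bound : (turan r n v e)%:Q
      <= q%:Q * (binz n (p + 1) / binz r (p + 1)).
    have := @turan_le_binz n r v e (p + 1) (p + 1) e.-1 0 ceil_ok ceil_ok.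
    rewrite !mul0r !addr0 q_eq.
    have -> : e%:Z - 1 = e.-1%:Z by lia.
    by apply; [lia | nia].
  have -> : e%:Q - 1 - q%:Q = 0 by rewrite q_eq intrD mulrN1z subrr.
  by rewrite !mul0r !addr0.
have q3 : q%:Q < e%:Q - 1.
  have : q < e%:Z - 1 by rewrite lt_neqAle q_neq.
  by rewrite -(ltr_int rat) intrD mulrN1z.
have floorx : Num.floor x = p.
  apply: floor_def; rewrite intrD.
  by apply/andP; split; nra.
rewrite floorx in floor_ok *.
(* The indices add up to [q (p + 1) + (e - 1 - q) p = p (e - 1) + q = e r - v]. *)
have bound := @turan_le_binz n r v e (p + 1) p `|q|%N (e.-1 - `|q|)%N
  ceil_ok floor_ok.
have absq : `|q|%N%:Z = q by lia.
have absq' : (e.-1 - `|q|)%N%:Z = e%:Z - 1 - q by lia.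
have -> : e%:Q - 1 - q%:Q = (e%:Z - 1 - q)%:~R :> rat.
  by rewrite !intrD mulrN1z mulrNz.
by move: bound; rewrite absq' absq => bound; split; apply: bound; [lia|nia|lia|nia].
Qed.
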